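(* Let $K\ge2$ and let $i\in\mathbb Z$. There exists a 1-parameter family (indexed by a parameter $\alpha\in\mathbb R$, different parameters giving different functions) of functions $\psi_{i+\frac12}\colon\mathbb R\to\mathbb R$ supported in $[x_{i-\frac12},x_{i+\frac32}]$, whose restrictions onto $(x_{i-\frac12},x_{i+\frac12})$ and onto $(x_{i+\frac12},x_{i+\frac32})$ are in $P^K$ (polynomials of degree at most $K$), and which satisfy, for all $j\in\mathbb Z$ and all $k\in\{0,\dots,K-2\}$, $$(\psi_{i+\frac12},\phi_{j+\frac12})_{L^2}=\delta_{ij},\qquad(\psi_{i+\frac12},\phi^{(k)}_j)_{L^2}=0,$$ where $\phi_{j+\frac12}$ and $\phi_j^{(k)}$ are the global Active Flux basis functions.
   Context: Grid: $\Delta x>0$, interfaces $x_{i+\frac12}$ ($i\in\mathbb Z$) with $x_{i+\frac12}-x_{i-\frac12}=\Delta x$, and cell centres $x_i=\frac12(x_{i-\frac12}+x_{i+\frac12})$. $\mathbb 1_I$ is the characteristic function of the set $I$, and $(u,v)_{L^2}=\int_{\mathbb R}u(x)v(x)\,\mathrm dx$. Local element: let $E=[-\frac{\Delta x}2,\frac{\Delta x}2]$, $V=P^K(E)$ (polynomials of degree at most $K$ on $E$), and let $(A_k)_{k=0,\dots,K-2}$ be a basis of $P^{K-2}$. The degrees of freedom are the linear functionals on $V$ $$\sigma_{\pm\frac12}(v)=v\left(\pm\tfrac{\Delta x}{2}\right),\qquad \sigma_k(v)=\int_E A_k(x)v(x)\,\mathrm dx,\quad k=0,\dots,K-2.$$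 The local basis $\{B_{-\frac12},B_{+\frac12},B_0,\dots,B_{K-2}\}$ of $V$ is the dual one: $\sigma_r(B_s)=\delta_{rs}$ for all $r,s\in\{\pm\frac12,0,1,\dots,K-2\}$ (the indices $0,1,\dots,K-2$ refer to moments, the indices $\pm\frac12$ to point values). Global basis functions: $$\phi_i^{(k)}(x)=B_k(x-x_i)\,\mathbb 1_{[x_{i-\frac12},x_{i+\frac12}]}(x),$$ $$\phi_{i+\frac12}(x)=B_{+\frac12}(x-x_i)\,\mathbb 1_{[x_{i-\frac12},x_{i+\frac12})}(x)+B_{-\frac12}(x-x_{i+1})\,\mathbb 1_{[x_{i+\frac12},x_{i+\frac32}]}(x).$$ Functions are identified if they agree almost everywhere. *)

(* Defs.v *)
From mathcomp Require Import all_boot all_order all_algebra.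
From mathcomp Require Export qpoly.
From mathcomp Require Import all_classical all_reals all_analysis.
Set Implicit Arguments.
Unset Strict Implicit.
Unset Printing Implicit Defensive.
Import Order.TTheory GRing.Theory Num.Theory.
Import numFieldNormedType.Exports.
Local Open Scope classical_set_scope.
Local Open Scope ring_scope.

(* {poly_n R} bounds the size, i.e. 1 + the degree: P^K is {poly_(K.+1) R},
   and P^(K-2) is {poly_(K.-1) R} when 2 <= K. *)

Definition L2prod (R : realType) (u v : R -> R) : R :=
  (\int[lebesgue_measure]_x (u x * v x))%R.

(* Index set {-1/2, +1/2, 0, ..., K-2} of the degrees of freedom. *)
Definition dof (K : nat) : finType := (bool + 'I_K.-1)%type.
Definition pt_left (K : nat) : dof K := inl false.
Definition pt_right (K : nat) : dof K := inl true.
Definition moment (K : nat) (k : 'I_K.-1) : dof K := inr k.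

Definition sigma (R : realType) (K : nat) (dx : R)
    (A : (K.-1).-tuple {poly_(K.-1) R}) (r : dof K) (v : {poly_(K.+1) R}) : R :=
  match r with
  | inl false => v.[- (dx / 2)]
  | inl true => v.[dx / 2]
  | inr k =>
      (\int[lebesgue_measure]_(x in `[(- (dx / 2))%R, (dx / 2)%R])
         ((tnth A k).[x] * v.[x]))%R
  end.

Definition dual_basis (R : realType) (K : nat) (dx : R)
    (A : (K.-1).-tuple {poly_(K.-1) R}) (B : dof K -> {poly_(K.+1) R}) : Prop :=
  forall r s : dof K, sigma dx A r (B s) = (r == s)%:R.

(* Throughout, xh i stands for the interface x_{i+1/2}; hence xh (i - 1) is
   x_{i-1/2} and xh (i + 1) is x_{i+3/2}. *)

Definition uniform_grid (R : realType) (dx : R) (xh : int -> R) : Prop :=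
  forall i : int, xh i - xh (i - 1) = dx.

Definition center (R : realType) (xh : int -> R) (i : int) : R :=
  (xh (i - 1) + xh i) / 2.

Definition phi_moment (R : realType) (K : nat) (xh : int -> R)
    (B : dof K -> {poly_(K.+1) R}) (i : int) (k : 'I_K.-1) (x : R) : R :=
  (B (moment k)).[x - center xh i] * \1_`[xh (i - 1), xh i] x.

(* phi_{i+1/2} *)
Definition phi_point (R : realType) (K : nat) (xh : int -> R)
    (B : dof K -> {poly_(K.+1) R}) (i : int) (x : R) : R :=
  (B (pt_right K)).[x - center xh i] * \1_`[xh (i - 1), xh i[ x
  + (B (pt_left K)).[x - center xh (i + 1)] * \1_`[xh i, xh (i + 1)] x.

Definition poly_on (R : realType) (n : nat) (D : set R) (f : R -> R) : Prop :=
  exists p : {poly_(n.+1) R}, forall x, D x -> f x = p.[x].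

(* For closed D, which is the only case used, this is equivalent to the
   closure of [set x | f x != 0] being included in D. *)
Definition supported_in (R : realType) (D : set R) (f : R -> R) : Prop :=
  [set x | f x != 0] `<=` D.

(* Main.v *)
Require Import Defs.
From mathcomp Require Import all_boot all_order all_algebra.
From mathcomp Require Import all_classical all_reals all_analysis.
From mathcomp Require Import measurable_realfun.
From HB Require Import structures.
From mathcomp Require Import ring lra.
Set Implicit Arguments.
Unset Strict Implicit.
Unset Printing Implicit Defensive.
Import Order.TTheory GRing.Theory Num.Theory.
Import numFieldNormedType.Exports.
Local Open Scope classical_set_scope.
Local Open Scope ring_scope.

(** The unknown function lives on two neighbouring cells, and on each of them its
    inner products with the basis functions can be prescribed separately.  The
    local basis [B] is linearly independent, since the degrees of freedom are
    linear and dual to it ([dual_basis_free]); as the inner product of a cell is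
    definite on polynomials ([polyint_sqr_eq0]), the Gram matrix of [B] is
    invertible ([gram_dual]), so that [B] has an L2-dual family on every cell
    ([cell_dual]).

    Let [D] be the element dual to the right point value on cell [i], and [D']
    the one dual to the left point value on cell [i + 1].  Each basis function
    other than the one of the interface [i] is orthogonal to both, while that
    one has inner product 1 with each of them.  Hence
    [alpha * D + (1 - alpha) * D'], each polynomial being extended by zero, has
    the required inner products for every [alpha].  The parameter is recovered
    as the inner product with the restriction of the interface function to cell
    [i], so that it depends only on the class modulo almost everywhere equality.

    The cells are taken half-open: they are then pairwise disjoint, and the basis
    functions agree with their half-open versions off the countable set of
    interfaces ([phi_point_ae], [phi_moment_ae]). *)

(** * Dual families for a bilinear form *)

(** A linearly independent family on whose span the form [f] is nondegenerate has
    an invertible Gram matrix, hence a dual family in that span. *)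
Lemma gram_dual (F : fieldType) (V : lmodType F) (I : finType)
    (f : V -> {scalar V}) (b : I -> V) :
  (forall c : I -> F,
     (forall s, f (b s) (\sum_r c r *: b r) = 0) -> forall r, c r = 0) ->
  forall r, exists c : I -> F,
    forall s, f (b s) (\sum_t c t *: b t) = (r == s)%:R.
Proof.
move=> b_free r.
pose G := \matrix_(s < #|I|, t < #|I|) f (b (enum_val t)) (b (enum_val s)).
have fE (v : 'rV_#|I|) s :
    f (b s) (\sum_t v 0 (enum_rank t) *: b t) = (v *m G) 0 (enum_rank s).
  rewrite linear_sum mxE (reindex_onto enum_val enum_rank) => [|t _]; last first.
    exact: enum_rankK.
  apply: eq_big => [t|t _]; first by rewrite enum_valK eqxx.
  by rewrite linearZ /= mxE enum_valK enum_rankK.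
have Gunit : G \in unitmx.
  rewrite -row_free_unit; apply: inj_row_free => v vG0.
  have v0 := b_free (fun t => v 0 (enum_rank t)).
  apply/rowP => k; rewrite mxE -[k]enum_valK; apply: v0 => s.
  by rewrite fE vG0 mxE.
pose v : 'rV_#|I| := delta_mx 0 (enum_rank r) *m invmx G.
exists (fun t => v 0 (enum_rank t)) => s.
by rewrite fE mulmxKV // mxE eqxx /= eq_sym (inj_eq enum_rank_inj).
Qed.

(** * Integrals of polynomials over segments *)

Section PolyInt.
Variable R : realType.
Local Notation mu := (@lebesgue_measure R).

Lemma continuous_horner_shift (p : {poly R}) (c : R) :
  continuous (fun x : R => p.[x - c]).
Proof.
have -> : (fun x : R => p.[x - c]) = horner (p \Po ('X - c%:P)).
  by apply/funext => x; rewrite horner_comp !hornerE.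
exact: continuous_horner.
Qed.

Lemma integrable_horner_shift (p : {poly R}) (c l r : R) :
  mu.-integrable `[l, r] (EFin \o (fun x : R => p.[x - c])).
Proof.
apply: continuous_compact_integrable; first exact: segment_compact.
apply: continuous_subspaceT; exact: continuous_horner_shift.
Qed.

(** The integral over [[l, r]] of the polynomial [p], taken in the variable
    relative to the origin [c]. *)
Definition polyint (l r c : R) (p : {poly R}) : R :=
  (\int[mu]_(x in `[l, r]) p.[x - c])%R.

Lemma polyint_is_linear l r c : linear_for *%R (polyint l r c).
Proof.
move=> a p q; rewrite /polyint.
under eq_Rintegral do rewrite hornerD hornerZ.
rewrite RintegralD ?RintegralZl //; try exact: integrable_horner_shift.
have := integrable_horner_shift (a *: p) c l r.
by congr (_.-integrable _ _); apply/funext => x /=; rewrite hornerZ.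
Qed.

HB.instance Definition _ l r c :=
  GRing.isLinear.Build R {poly R} R *%R (polyint l r c) (polyint_is_linear l r c).

Lemma countable_negligible (D : set R) : countable D -> mu.-negligible D.
Proof.
move=> cD; apply/negligibleP; last exact: countable_lebesgue_measure0.
by apply: countable_measurable => // t; exact: measurable_set1.
Qed.

Lemma infinite_roots_eq0 (p : {poly R}) (D : set R) :
  infinite_set D -> (forall x, D x -> root p x) -> p = 0.
Proof.
move=> infD Dp; apply/eqP; apply: contraT => p0.
have [X XD sX] := infinite_set_fset (size p) infD.
have rX : all (root p) (finmap.enum_fset X).
  by apply/allP => x xX; apply: Dp; exact: XD.
by have := max_poly_roots p0 rX (finmap.fset_uniq X); rewrite ltnNge sX.
Qed.

(** The integrand vanishes almost everywhere, hence at infinitely many points,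
    because a finite set cannot fill up the segment. *)
Lemma polyint_sqr_eq0 l r c (p : {poly R}) :
  l < r -> polyint l r c (p * p) = 0 -> p = 0.
Proof.
move=> lr; rewrite /polyint /Rintegral => /eqP.
have mD : measurable (`[l, r]%classic : set R) by [].
have ip := integrable_horner_shift (p * p) c l r.
rewrite fine_eq0; last exact: integrable_fin_num.
move=> /eqP int0.
have : (\int[mu]_(x in `[l, r]) `|(p * p).[x - c]%:E|)%E = 0%E.
  rewrite -[RHS]int0; apply: eq_integral => x _.
  by rewrite gee0_abs // lee_fin hornerM -expr2 sqr_ge0.
move/(ae_eq_integral_abs mu mD (measurable_int _ ip)) => ae0.
pose Z := [set x : R | root p x].
have infZ : infinite_set Z.
  move=> finZ.
  pose W := [set x : R | root p (x - c)].
  have W0 : mu.-negligible W.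
    apply: countable_negligible; apply: finite_set_countable.
    apply: (finite_preimage (f := fun x : R => x - c) _ finZ).
    by move=> x y _ _ /addIr.
  have : mu.-negligible (`[l, r]%classic : set R).
    apply: negligibleS (negligibleU ae0 W0).
    move=> x xlr; case: (pselect (W x)) => Wx; [by right|left] => /= H.
    apply: Wx; have [] := H xlr.
    by rewrite hornerM => /eqP; rewrite mulf_eq0 orbb.
  move/negligibleP => /(_ mD) mu0.
  have := lebesgue_measure_itv `[l, r].
  rewrite (mu0 : mu `[l, r] = 0%E) /= lte_fin lr => -[] /esym/eqP.
  by rewrite subr_eq0 gt_eqF.
exact: infinite_roots_eq0 infZ _.
Qed.
End PolyInt.

(** * Piecewise polynomials on the grid *)

Section Cells.
Variables (R : realType) (dx : R) (xh : int -> R).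
Hypotheses (hdx : 0 < dx) (hxh : uniform_grid dx xh).
Local Notation mu := (@lebesgue_measure R).

(** The polynomial [p] on the cell [i], in the variable relative to its centre,
    extended by zero.  The cell is half-open, so that the cells partition the
    line. *)
Definition cellfun (i : int) (p : {poly R}) (x : R) : R :=
  p.[x - Defs.center xh i] * \1_`]xh (i - 1), xh i] x.

(** The integral over the cell [i] of a polynomial in the local variable. *)
Definition cellint (i : int) : {poly R} -> R :=
  polyint (xh (i - 1)) (xh i) (Defs.center xh i).

Lemma interface_addn (i : int) (n : nat) : xh (i + n%:Z) = xh i + dx *+ n.
Proof.
elim: n => [|n IH]; first by rewrite addr0 mulr0n addr0.
have := hxh (i + n.+1%:Z).
have -> : i + n.+1%:Z - 1 = i + n%:Z by rewrite intS; ring.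
by move/eqP; rewrite subr_eq IH => /eqP ->; rewrite mulrS; ring.
Qed.

Lemma interface_le : {homo xh : i j / i <= j}.
Proof.
move=> i j; rewrite -subr_ge0 => ij.
have -> : j = i + `|j - i|%N%:Z by rewrite gez0_abs //; ring.
by rewrite interface_addn lerDl mulrn_wge0 // ltW.
Qed.

Lemma interface_lt (i : int) : xh (i - 1) < xh i.
Proof. by rewrite -subr_gt0 hxh. Qed.

Lemma cell_disjoint (i j : int) (x : R) :
  x \in `]xh (i - 1), xh i] -> x \in `]xh (j - 1), xh j] -> i = j.
Proof.
wlog ij : i j / i <= j.
  by move=> W xi xj; case/orP: (le_total i j) => ij; [|symmetry]; apply: W.
rewrite !in_itv /= => /andP[_ xi] /andP[jx _].
apply/le_anti; rewrite ij /= leNgt; apply/negP => lt_ij.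
have /interface_le : i <= j - 1 by rewrite -ltzD1 subrK.
by move=> /(le_trans xi) /(lt_le_trans jx); rewrite ltxx.
Qed.

Lemma measurable_cellfun i p : measurable_fun [set: R] (cellfun i p).
Proof.
apply: measurable_funM; last exact: measurable_indic.
apply: continuous_measurable_fun; exact: continuous_horner_shift.
Qed.

Lemma cellfunM i j p q x :
  cellfun i p x * cellfun j q x = (i == j)%:R * cellfun i (p * q) x.
Proof.
rewrite /cellfun !indicE; case: eqVneq => [<-|ij].
  by rewrite mul1r hornerM; case: (_ \in _) => /=; ring.
rewrite mul0r !mem_setE.
case: (boolP (x \in `]xh (i - 1), xh i])) => xi; last by rewrite mulr0 mul0r.
case: (boolP (x \in `]xh (j - 1), xh j])) => xj; last by rewrite !mulr0.
by rewrite (cell_disjoint xi xj) eqxx in ij.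
Qed.

Lemma cellfun_patch i p :
  cellfun i p = (fun x => p.[x - Defs.center xh i]) \_ `]xh (i - 1), xh i].
Proof.
apply/funext => x; rewrite /cellfun /patch indicE.
by case: (_ \in _); rewrite ?mulr1 ?mulr0.
Qed.

Lemma integrable_half_open i p :
  mu.-integrable `]xh (i - 1), xh i]
    (EFin \o (fun x => p.[x - Defs.center xh i])).
Proof.
have := integrable_horner_shift p (Defs.center xh i) (xh (i - 1)) (xh i).
by apply: integrableS => //; exact: subset_itv_oc_cc.
Qed.

Lemma integrable_cellfun i p : mu.-integrable [set: R] (EFin \o cellfun i p).
Proof.
rewrite cellfun_patch.
have /(integrable_mkcond _) := integrable_half_open i p.
rewrite restrict_EFin; apply; exact: measurable_itv.
Qed.

Lemma Rintegral_cellfun i p : (\int[mu]_x cellfun i p x)%R = cellint i p.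
Proof.
rewrite cellfun_patch -Rintegral_mkcond Rintegral_itv_obnd_cbnd //.
exact: integrable_half_open.
Qed.

Lemma ae_eq_L2prod (u u' v v' : R -> R) :
  measurable_fun [set: R] u -> measurable_fun [set: R] u' ->
  measurable_fun [set: R] v -> measurable_fun [set: R] v' ->
  u = u' %[ae mu] -> v = v' %[ae mu] -> L2prod u v = L2prod u' v'.
Proof.
move=> mu1 mu2 mv1 mv2 uu' vv'; rewrite /L2prod /Rintegral; congr fine.
apply: ae_eq_integral => //.
- by apply/measurable_EFinP; exact: measurable_funM.
- by apply/measurable_EFinP; exact: measurable_funM.
have aeF := ae_filter_ringOfSetsType mu.
apply: (filterS2 _ _ uu' vv') => x {}uu' {}vv' xT.
by rewrite uu' ?vv'.
Qed.

(** Bilinearity and disjointness of the cells.  Two cells on each side are what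
    the inner product of the constructed function with an interface function
    requires; [s = 0] gives the case of a single cell on the right. *)
Lemma L2prod_cellfun2 a b i j p q k r l s :
  L2prod (fun x => a * cellfun i p x + b * cellfun j q x)
         (fun x => cellfun k r x + cellfun l s x)
  = a * (i == k)%:R * cellint i (p * r) + a * (i == l)%:R * cellint i (p * s)
  + b * (j == k)%:R * cellint j (q * r) + b * (j == l)%:R * cellint j (q * s).
Proof.
rewrite /L2prod.
have E x :
    (a * cellfun i p x + b * cellfun j q x) * (cellfun k r x + cellfun l s x) =
    a * (i == k)%:R * cellfun i (p * r) x + a * (i == l)%:R * cellfun i (p * s) x
  + b * (j == k)%:R * cellfun j (q * r) x + b * (j == l)%:R * cellfun j (q * s) x.
  by rewrite -!mulrA -!cellfunM; ring.
under eq_Rintegral do rewrite E.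
have I c n f : mu.-integrable [set: R] (EFin \o (fun x => c * cellfun n f x)).
  by have := integrableZl (measurableT) c (integrable_cellfun n f); apply.
have D f g : mu.-integrable [set: R] (EFin \o f) ->
    mu.-integrable [set: R] (EFin \o g) ->
    mu.-integrable [set: R] (EFin \o (fun x => f x + g x)).
  by move=> F G; exact: (integrableD measurableT F G).
rewrite (RintegralD measurableT
  (D _ _ (D _ _ (I _ _ _) (I _ _ _)) (I _ _ _)) (I _ _ _)).
rewrite (RintegralD measurableT (D _ _ (I _ _ _) (I _ _ _)) (I _ _ _)).
rewrite (RintegralD measurableT (I _ _ _) (I _ _ _)).
by rewrite !RintegralZl ?Rintegral_cellfun //; exact: integrable_cellfun.
Qed.

Lemma ae_off_interfaces : {ae mu, forall x, ~ range xh x}.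
Proof.
have : mu.-negligible (range xh).
  apply: countable_negligible.
  by apply: card_le_trans (card_image_le _ _) _; exact: countableP.
by apply: negligibleS => x /=; rewrite not_notE.
Qed.

Lemma cell_indic_off_interfaces b1 b2 i x : ~ range xh x ->
  \1_[set` Interval (BSide b1 (xh (i - 1))) (BSide b2 (xh i))] x =
  \1_`]xh (i - 1), xh i] x :> R.
Proof.
move=> xNxh; have neq j : (xh j == x) = false.
  by apply/eqP => jx; apply: xNxh; exists j.
rewrite !indicE !mem_setE !in_itv /=.
by case: b1 b2 => [] []; rewrite /= ?le_eqVlt ![x == _]eq_sym ?neq.
Qed.

(** * The local basis and its dual on a cell *)

Section Dual.
Variables (K : nat) (A : (K.-1).-tuple {poly_(K.-1) R}).
Variable (B : dof K -> {poly_(K.+1) R}).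
Hypothesis (hB : dual_basis dx A B).

Lemma phi_point_ae i :
  phi_point xh B i = (fun x => cellfun i (B (pt_right K)) x +
    cellfun (i + 1) (B (pt_left K)) x) %[ae mu].
Proof.
have aeF := ae_filter_ringOfSetsType mu.
apply: filterS ae_off_interfaces => x xNxh _.
rewrite /phi_point /cellfun addrK.
have -> := cell_indic_off_interfaces true true i xNxh.
by have := cell_indic_off_interfaces true false (i + 1) xNxh; rewrite addrK => ->.
Qed.

Lemma phi_moment_ae i k :
  phi_moment xh B i k =
    (fun x => cellfun i (B (moment k)) x + cellfun i 0 x) %[ae mu].
Proof.
have aeF := ae_filter_ringOfSetsType mu.
apply: filterS ae_off_interfaces => x xNxh _.
rewrite /phi_moment /cellfun horner0 mul0r addr0.
by have -> := cell_indic_off_interfaces true false i xNxh.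
Qed.

Lemma measurable_phi_point i : measurable_fun [set: R] (phi_point xh B i).
Proof.
by apply: measurable_funD; apply: measurable_funM; try exact: measurable_indic;
  apply: continuous_measurable_fun; exact: continuous_horner_shift.
Qed.

Lemma measurable_phi_moment i k : measurable_fun [set: R] (phi_moment xh B i k).
Proof.
apply: measurable_funM; last exact: measurable_indic.
apply: continuous_measurable_fun; exact: continuous_horner_shift.
Qed.

Lemma dual_basis_free (c : dof K -> R) :
  \sum_s c s *: B s = 0 -> forall r, c r = 0.
Proof.
move=> cB0 r.
have cB0' : \sum_s c s *: (B s : {poly R}) = 0.
  by have := congr1 val cB0; rewrite raddf_sum.
(* It suffices to extend the degree of freedom [r] linearly to all polynomials. *)
have key (L : {scalar {poly R}}) : (forall s, L (B s) = (r == s)%:R) -> c r = 0.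
  move=> LB; have := congr1 L cB0'; rewrite linear0 linear_sum (bigD1 r) //=.
  rewrite big1 => [|s sr]; rewrite linearZ /= LB ?eqxx ?mulr1 ?addr0 //.
  by rewrite eq_sym (negPf sr) mulr0.
have := hB r; case: r key => [[]|k] key hBr.
- by apply: (key (horner_eval (dx / 2))) => s; exact: hBr.
- by apply: (key (horner_eval (- (dx / 2)))) => s; exact: hBr.
- pose L p := polyint (- (dx / 2)) (dx / 2) 0 ((tnth A k : {poly R}) * p).
  have Llin : linear_for *%R L.
    by move=> a p q; rewrite /L mulrDr -scalerAr linearP.
  pose LL := GRing.isLinear.Build R {poly R} R *%R L Llin.
  pose L' : {scalar {poly R}} := HB.pack L LL.
  apply: (key L') => s; rewrite -hBr /= /L /polyint.
  by apply: eq_Rintegral => x _; rewrite subr0 hornerM.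
Qed.

(** The L2-dual of [B] on the cell [i], within polynomials of degree at most
    [K]. *)
Lemma cell_dual i r : exists D : {poly_(K.+1) R},
  forall s, cellint i ((D : {poly R}) * B s) = (r == s)%:R.
Proof.
pose f (p q : {poly_(K.+1) R}) := cellint i ((q : {poly R}) * p).
have flin p : linear_for *%R (f p).
  by move=> a u v; rewrite /f /= mulrDl -scalerAl /cellint linearP.
pose F p : {scalar {poly_(K.+1) R}} :=
  HB.pack (f p) (GRing.isLinear.Build R {poly_(K.+1) R} R *%R (f p) (flin p)).
have gram_free c :
    (forall s, F (B s) (\sum_t c t *: B t) = 0) -> forall t, c t = 0.
  (* [v] is orthogonal to the whole family, hence to itself. *)
  set v := \sum_t _ => cB0.
  suff v0 : val v = 0 by apply: dual_basis_free; exact: val_inj.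
  apply: (polyint_sqr_eq0 (c := Defs.center xh i) (interface_lt i)).
  have fC p q : f p q = f q p by rewrite /f mulrC.
  have vE : v = \sum_t c t *: B t by [].
  change (F v v = 0); rewrite [in X in F _ X]vE linear_sum big1 // => s _.
  by rewrite linearZ /= fC [f _ _]cB0 mulr0.
have [c cP] := gram_dual gram_free r.
by exists (\sum_t c t *: B t) => s; exact: cP.
Qed.
End Dual.
End Cells.

(** * The one-parameter family *)

Lemma poly_on_shift (R : realType) (K : nat) (D : set R) (f : R -> R) (c : R)
    (p : {poly_(K.+1) R}) : (forall x, D x -> f x = p.[x - c]) -> poly_on K D f.
Proof.
move=> fp; exists (npolyp K.+1 ((p : {poly R}) \Po ('X - c%:P))) => x /fp ->.
rewrite npolypK ?size_comp_poly2 ?size_XsubC ?size_npoly //.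
by rewrite horner_comp !hornerE.
Qed.

Theorem theorem2p2 (R : realType) (K : nat) (hK : (2 <= K)%N)
    (dx : R) (hdx : 0 < dx) (xh : int -> R) (hxh : uniform_grid dx xh)
    (A : (K.-1).-tuple {poly_(K.-1) R}) (hA : basis_of fullv A)
    (B : dof K -> {poly_(K.+1) R}) (hB : dual_basis dx A B) (i : int) :
  exists psi : R -> R -> R,
    (forall alpha : R,
       [/\ supported_in `[xh (i - 1), xh (i + 1)] (psi alpha),
           poly_on K `]xh (i - 1), xh i[ (psi alpha),
           poly_on K `]xh i, xh (i + 1)[ (psi alpha),
           forall j : int, L2prod (psi alpha) (phi_point xh B j) = (i == j)%:R &
           forall (j : int) (k : 'I_K.-1),
             L2prod (psi alpha) (phi_moment xh B j k) = 0]) /\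
    (forall alpha beta : R,
       psi alpha = psi beta %[ae lebesgue_measure] -> alpha = beta).
Proof.
have [D DP] := cell_dual hdx hxh hB i (pt_right K).
have [D' D'P] := cell_dual hdx hxh hB (i + 1) (pt_left K).
pose psi (a x : R) := a * cellfun xh i D x + (1 - a) * cellfun xh (i + 1) D' x.
have mpsi a : measurable_fun [set: R] (psi a).
  apply: measurable_funD; apply: measurable_funM => //;
  exact: measurable_cellfun.
have mcells k l p q : measurable_fun [set: R]
    (fun x => cellfun xh k p x + cellfun xh l q x).
  by apply: measurable_funD; exact: measurable_cellfun.
have cellE j p x : cellfun xh j p x =
    if x \in `]xh (j - 1), xh j] then p.[x - Defs.center xh j] else 0.
  by rewrite /cellfun indicE mem_setE; case: ifP; rewrite ?mulr1 ?mulr0.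
have lt1 : xh (i - 1) < xh i by exact: interface_lt hxh _.
have lt2 : xh i < xh (i + 1).
  by have := interface_lt hdx hxh (i + 1); rewrite addrK.
have aer a : psi a = psi a %[ae @lebesgue_measure R] by exact: ae_eq_refl.
exists psi; split=> [a|a b psiab].
  split.
  - move=> x; rewrite /= /psi !cellE addrK !in_itv /=.
    by case: ifP; case: ifP; rewrite ?mulr0 ?addr0 ?eqxx //; lra.
  - apply: (poly_on_shift (c := Defs.center xh i) (p := a *: D)) => x /=.
    rewrite in_itv /= => xi; rewrite /psi !cellE addrK !in_itv /= hornerZ.
    by rewrite ifT ?ifF ?mulr0 ?addr0 //; lra.
  - apply: (poly_on_shift (c := Defs.center xh (i + 1)) (p := (1 - a) *: D')) => x.
    rewrite /= in_itv /= => xi; rewrite /psi !cellE addrK !in_itv /= hornerZ.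
    by rewrite ifF ?ifT ?mulr0 ?add0r //; lra.
  - move=> j.
    rewrite (ae_eq_L2prod (mpsi a) (mpsi a) (measurable_phi_point xh B j)
      (mcells _ _ _ _) (aer a) (phi_point_ae xh B j)).
    rewrite (L2prod_cellfun2 hdx hxh) !DP !D'P !eqxx /= (inj_eq (addIr 1)) /=.
    by ring.
  - move=> j k.
    rewrite (ae_eq_L2prod (mpsi a) (mpsi a) (measurable_phi_moment xh B j k)
      (mcells _ _ _ _) (aer a) (phi_moment_ae xh B j k)).
    by rewrite (L2prod_cellfun2 hdx hxh) !DP !D'P !mulr0 /cellint !linear0 /=; ring.
(* Testing against the left half of the interface function recovers [a]. *)
have L a' : L2prod (psi a')
    (fun x => cellfun xh i (B (pt_right K)) x + cellfun xh i 0 x) = a'.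
  rewrite (L2prod_cellfun2 hdx hxh) !DP !D'P !mulr0 /cellint !linear0 !eqxx /=.
  by ring.
rewrite -[a]L -[b]L; apply: (ae_eq_L2prod (mpsi a) (mpsi b) _ _ psiab).
- exact: mcells.
- exact: mcells.
- exact: ae_eq_refl.
Qed.
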